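(* Let $p\in[2,\infty)$ and $c>0$. Let $(\mathcal M,d)$ be a metric space with a locally finite Borel measure $\mu$, and let $X=X(\mathcal M)\subset L^p(\mathcal M)$ be a nontrivial Banach function space that is continuously and locally compactly imbedded in $L^p(\mathcal M)$. Let $E\in C(X(\mathcal M),\mathbb R)$ be a weak limit superadditive functional in $X$, and let $$t\mapsto E_t=\inf_{\substack{u\in X(\mathcal M)\\ \|u\|_p^p=t}}E(u)$$ be a strictly subadditive, continuous function of $t\in[0,c]$. Let $(u_n)$ be a minimizing sequence of $E_c$ and assume that there exists $u\in X$ such that, up to a subsequence, $u_n\rightharpoonup u$ weakly in $X$. Then either $u\equiv0$, or (along this subsequence) $u_n\to u$ strongly in $L^p(\mathcal M)$ and $u\not\equiv0$ is a minimizer of $E_c$.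
   Context: Locally compactly imbedded: for all $R>0$ and $y\in\mathcal M$, the restriction of $X(\mathcal M)$ to the ball $K_R(y)=\{x\in\mathcal M:\operatorname{dist}(x,y)\le R\}$ is compactly imbedded in $L^p(K_R(y))$. The functionals considered satisfy $E(0)=0$ and $E_t>-\infty$ for all $t\ge0$. A minimizing sequence of $E_c$ is a sequence $u_n\in X$ with $\|u_n\|_p^p=c$ and $E(u_n)\to E_c$; a minimizer of $E_c$ is $u\in X$ with $\|u\|_p^p=c$ and $E(u)=E_c$. Strictly subadditive: $E_{t_1+t_2}<E_{t_1}+E_{t_2}$ for all $t_1,t_2>0$ (with $t_1+t_2\le c$ for the map on $[0,c]$). Weak limit superadditive in $X$: for all $c>0$, any weakly convergent minimizing sequence $u_n\rightharpoonup u$ in $X$ of $E_c$ satisfies, up to a subsequence, $\limsup_{n\to\infty}E(u_n)\ge E(u)+\limsup_{n\to\infty}E(u_n-u)$. *)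

(* Defs.v *)
From HB Require Import structures.
From mathcomp Require Import all_boot all_order all_algebra.
From mathcomp.real_closed Require Import complex.
From mathcomp Require Import all_classical all_reals all_analysis.

Set Implicit Arguments.
Unset Strict Implicit.
Unset Printing Implicit Defensive.
Import Order.TTheory GRing.Theory Num.Theory.
Import numFieldNormedType.Exports.
Local Open Scope classical_set_scope.
Local Open Scope ring_scope.
Local Open Scope complex_scope.

(* MathComp-Analysis generates sigma-algebras on pointed types only; a metric
   space that carries a nonzero function is nonempty anyway. *)
#[short(type="pointedMetricType")]
HB.structure Definition PointedMetric (R : numDomainType) :=
  { M of Metric R M & isPointed M }.

Notation borelType M := (g_sigma_algebraType (@open M)).

Section MetricMeasureSpace.
Context {R : realType} {M : pointedMetricType R}.

Definition locally_finite (mu : set (borelType M) -> \bar R) : Prop :=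
  forall x : M, exists U : set M, open_nbhs x U /\ (mu U < +oo)%E.

Definition Kball (y : M) (r : R) : set (borelType M) :=
  [set x : M | mdist x y <= r].

Lemma measurable_Kball (y : M) (r : R) : measurable (Kball y r).
Proof.
rewrite -[Kball y r]setCK; apply: measurableC; apply: sub_sigma_algebra.
rewrite openE => x /= /negP; rewrite -ltNge => rx.
apply/nbhs_ballP; exists (mdist x y - r) => /=; first by rewrite subr_gt0.
move=> z; rewrite ballEmdist /= => xz; apply/negP; rewrite -ltNge.
rewrite -(ltrD2l (mdist x z)); apply: lt_le_trans (metric_triangle x z y).
by rewrite -ltrBrDr.
Qed.

End MetricMeasureSpace.

(* L^p spaces of complex-valued functions; a real-valued function is one with
   zero imaginary part. Elements are handled through representatives, equality
   being equality almost everywhere. *)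
Section Lp.
Context {d : measure_display} {T : measurableType d} {R : realType}.
Variables (mu : {measure set T -> \bar R}) (p : R).

Definition Lp_norm (f : T -> R[i]) : \bar R :=
  Lnorm mu p%:E (fun x => (Normc.normc (f x))%:E).

Definition in_Lp (f : T -> R[i]) : Prop :=
  [/\ measurable_fun setT (fun x => complex.Re (f x)),
      measurable_fun setT (fun x => complex.Im (f x)) &
      (Lp_norm f < +oo)%E].

End Lp.

Definition subsequence (phi : nat -> nat) : Prop :=
  {homo phi : m n / (m < n)%N}.

Definition weakly_converges {R : realType} {X : normedModType R}
    (u_ : nat -> X) (u : X) : Prop :=
  forall f : {linear X -> R^o}, continuous f ->
    f (u_ n) @[n --> \oo] --> f u.

(* A space X of functions contained in L^p is a normed space together with the
   inclusion iota, which sends each element to a representative of its class.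
   X is a real vector space: when the functions form a complex Banach space,
   X is that space with scalars restricted to the reals, which changes neither
   its norm nor its weakly convergent sequences. *)
Section FunctionSpace.
Context {R : realType} {M : pointedMetricType R}.
Variables (mu : {measure set (borelType M) -> \bar R}) (p : R).
Variables (X : normedModType R) (iota : X -> borelType M -> R[i]).

Definition function_space_in_Lp : Prop :=
  [/\ forall u, in_Lp mu p (iota u),
      forall (a : R) (u v : X),
        iota (a *: u + v) = (fun x => a%:C * iota u x + iota v x) %[ae mu] &
      forall u, iota u = (fun=> 0) %[ae mu] -> u = 0].

Definition continuously_imbedded : Prop :=
  exists C : R, forall u : X, (Lp_norm mu p (iota u) <= (C * `|u|)%R%:E)%E.

(* L^p(K_r(y)) is L^p for the restriction of mu to K_r(y); the restriction map
   X -> L^p(K_r(y)) is a compact operator. *)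
Definition locally_compactly_imbedded : Prop :=
  forall (y : M) (r : R), 0 < r ->
  let muK := mrestr mu (measurable_Kball y r) in
  forall u_ : nat -> X, (exists C : R, forall n, `|u_ n| <= C) ->
  exists (phi : nat -> nat) (g : borelType M -> R[i]),
    [/\ subsequence phi, in_Lp muK p g &
        Lp_norm muK p (fun x => iota (u_ (phi n)) x - g x) @[n --> \oo]
          --> 0%E].

Definition mass (u : X) : \bar R := poweR (Lp_norm mu p (iota u)) p.

Variable E : X -> R.

Definition ground_energy (t : R) : \bar R :=
  ereal_inf [set (E u)%:E | u in [set u | mass u = t%:E]].

Definition minimizing_sequence (t : R) (u_ : nat -> X) : Prop :=
  (forall n, mass (u_ n) = t%:E) /\
  (E (u_ n))%:E @[n --> \oo] --> ground_energy t.

Definition minimizer (t : R) (u : X) : Prop :=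
  mass u = t%:E /\ (E u)%:E = ground_energy t.

Definition weak_limit_superadditive : Prop :=
  forall (t : R), 0 < t ->
  forall (u_ : nat -> X) (u : X),
    minimizing_sequence t u_ -> weakly_converges u_ u ->
  exists phi : nat -> nat, subsequence phi /\
    (limn_esup (fun n => (E (u_ (phi n)))%:E) >=
     (E u)%:E + limn_esup (fun n => (E (u_ (phi n) - u)%R)%:E))%E.

End FunctionSpace.

Definition strictly_subadditive_upto {R : realType} (f : R -> \bar R) (c : R)
    : Prop :=
  forall t1 t2 : R, 0 < t1 -> 0 < t2 -> t1 + t2 <= c ->
    (f (t1 + t2)%R < f t1 + f t2)%E.

(* Main.v *)
From HB Require Import structures.
Require Import Defs.
From mathcomp Require Import all_boot all_order all_algebra.
From mathcomp.real_closed Require Import complex.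
From mathcomp Require Import all_classical all_reals all_analysis.
From mathcomp Require Import measurable_realfun ring lra.
Import Order.TTheory GRing.Theory Num.Theory.
Import numFieldNormedType.Exports.
Local Open Scope classical_set_scope.
Local Open Scope ring_scope.

(* Write [v_n] for the weakly convergent subsequence, [u] for its limit and
   [t = |u|_p^p]. A weakly convergent sequence is bounded, so by the local
   compactness of the imbedding and the identification of the limit,
   [v_n -> u] strongly in [L^p] of every ball. Since [u] is small in [L^p] off
   a large ball, the norms split: [|v_n - u|_p^p -> c - t]. If [u != 0] then
   [0 < t <= c], and weak limit superadditivity together with the continuity of
   [t |-> E_t] gives [E_c >= E(u) + E_(c-t) >= E_t + E_(c-t)]; strict
   subadditivity then forces [t = c], so that [|v_n - u|_p -> 0] and
   [E_c >= E(u) + E_0 = E(u)]. *)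

(** * Hahn-Banach theorem and weakly convergent sequences *)

Section HahnBanach.
Context {R : realType} {X : lmodType R}.
Implicit Types (p q : X -> R) (x y z : X).

(** The compactness hypothesis speaks of norm-bounded sequences and yields an anonymous limit in
    [L^p] of a ball, so two links to weak convergence have to be built. Boundedness: an unbounded
    sequence admits a single continuous functional that is unbounded along it, summed by a gliding
    hump from norming functionals; these come from Hahn-Banach. Identification: integrals over sets
    of finite measure are continuous functionals on [X], and they test the compactness limit against
    [u]. Since compactness only gives subsequences, convergence of the full sequence on a ball is
    proved by contradiction. The condition [u != 0] enters twice through [0 < t]: strict
    subadditivity asks for it, and it gives [c - t < c], which keeps the masses of [v_n - u]
    eventually inside [[0, c]], where [E_t] is continuous. *)

Definition sublinear q : Prop :=
  (forall x y, q (x + y) <= q x + q y) /\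
  (forall (a : R) x, 0 < a -> q (a *: x) <= a * q x).

(** The one-sided bound applied to [a^-1] gives the reverse one; at [a = 0] the factors [2] and
    [2^-1] squeeze [q 0] to [0]. Keeping one inequality in the definition makes it easier to check
    for infima. *)
Lemma sublinearZ {q} : sublinear q ->
  forall (a : R) x, 0 <= a -> q (a *: x) = a * q x.
Proof.
case=> _ qZ a x; rewrite le_eqVlt => /predU1P[<-|a0].
  rewrite scale0r mul0r; apply/eqP; rewrite eq_le.
  have := qZ 2 0 (ltr0Sn _ _); have := qZ 2^-1 0.
  rewrite !scaler0 invr_gt0 ltr0Sn => /(_ isT); lra.
apply/eqP; rewrite eq_le qZ//=.
have := qZ a^-1 (a *: x); rewrite invr_gt0 => /(_ a0).
by rewrite scalerA mulVf ?gt_eqF// scale1r -ler_pdivlMl.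
Qed.

Lemma sublinear_ge_opp {q} : sublinear q -> forall x, - q (- x) <= q x.
Proof.
move=> sq x; have := sq.1 x (- x); have := sublinearZ sq 0 0 (lexx _).
by rewrite scale0r mul0r subrr => ->; lra.
Qed.

(** Common frame for the two infima below: over the parameter of a tilt, and over a chain in Zorn's
    lemma. *)
Lemma sublinear_inf {S : Type} (D : X -> set S) (F : S -> X -> R) :
  (forall x, D x !=set0) ->
  (forall x, has_lbound [set F s x | s in D x]) ->
  (forall x y s t, D x s -> D y t ->
     exists2 r, D (x + y) r & F r (x + y) <= F s x + F t y) ->
  (forall (a : R) x s, 0 < a -> D x s ->
     exists2 r, D (a *: x) r & F r (a *: x) <= a * F s x) ->
  sublinear (fun x => inf [set F s x | s in D x]).
Proof.
move=> D0 Flb FD FZ.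
have ne x : [set F s x | s in D x] !=set0.
  by have [s Ds] := D0 x; exists (F s x), s.
split=> [x y|a x a0].
- rewrite -lerBlDr; apply: lb_le_inf => // _ [s Ds <-].
  rewrite lerBlDr -lerBlDl; apply: lb_le_inf => // _ [t Dt <-].
  rewrite lerBlDl; have [r Dr] := FD x y s t Ds Dt.
  by apply: le_trans; apply: ge_inf => //; exists r.
- rewrite -ler_pdivrMl//; apply: lb_le_inf => // _ [s Ds <-].
  rewrite ler_pdivrMl//; have [r Dr] := FZ a x s a0 Ds.
  by apply: le_trans; apply: ge_inf => //; exists r.
Qed.

(* The largest sublinear functional q' <= q with q' (- y) <= - q y; if q is
   minimal then q' = q, which makes q additive. *)
Definition tilt q y x : R :=
  inf [set q (x + t *: y) - t * q y | t in [set t | 0 <= t]].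

Lemma tilt_has_lbound {q} : sublinear q -> forall x y,
  has_lbound [set q (x + t *: y) - t * q y | t in [set t | 0 <= t]].
Proof.
move=> sq x y; exists (- q (- x)) => _ [t /= t0 <-].
rewrite -(sublinearZ sq)//.
have := sq.1 (x + t *: y) (- x); rewrite addrAC subrr add0r; lra.
Qed.

Lemma sublinear_tilt {q} : sublinear q -> forall y, sublinear (tilt q y).
Proof.
move=> sq y.
apply: (@sublinear_inf R (fun=> [set t | 0 <= t])
  (fun t x => q (x + t *: y) - t * q y)).
- by move=> x; exists 0 => /=.
- by move=> x; exact: tilt_has_lbound.
- move=> x z s t /= s0 t0; exists (s + t); first exact: addr_ge0.
  have := sq.1 (x + s *: y) (z + t *: y).
  by rewrite addrACA -scalerDl; lra.
- move=> a x s a0 /= s0; exists (a * s); first by rewrite mulr_ge0// ltW.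
  by rewrite -scalerA -scalerDr (sublinearZ sq) ?(ltW a0)// mulrBr mulrA.
Qed.

(** Two values of [t] matter: [0] gives [tilt q y <= q], and [1] gives
    [tilt q y x <= q (x + y) - q y]. *)
Lemma tilt_le {q} : sublinear q -> forall x y (t : R),
  0 <= t -> tilt q y x <= q (x + t *: y) - t * q y.
Proof. by move=> sq x y t t0; apply: ge_inf; [exact: tilt_has_lbound|exists t]. Qed.

Lemma minimal_sublinear p : sublinear p ->
  exists q, [/\ sublinear q, forall x, q x <= p x &
    forall q', sublinear q' -> (forall x, q' x <= q x) -> q' = q].
Proof.
move=> sp.
pose T := {q : X -> R | sublinear q /\ forall x, q x <= p x}.
(* The order is reversed, so that a maximal element for Zorn is a minimal functional. *)
pose r (s t : T) := `[< forall x, sval t x <= sval s x >].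
have [| | |A totA|[q [sq qp]] qmin] := @Zorn T r.
- by move=> s; apply/asboolP.
- move=> s t u /asboolP st /asboolP tu; apply/asboolP => x.
  exact: le_trans (tu x) (st x).
- move=> [s Hs] [t Ht] /asboolP /= st /asboolP /= ts; apply: eq_exist.
  by apply/funext => x; apply/eqP; rewrite eq_le st ts.
- have [->|/set0P A0] := eqVneq A set0.
    by exists (exist _ p (conj sp (fun=> lexx _))) => s.
  have lb x : has_lbound [set sval s x | s in A].
    exists (- p (- x)) => _ [[s [ss sp']] _ <-] /=.
    by apply: le_trans (sublinear_ge_opp ss x); rewrite lerN2.
  have si : sublinear (fun x => inf [set sval s x | s in A]).
    apply: (@sublinear_inf T (fun=> A) (fun s x => sval s x)) => //.
    + move=> x y s t As At; have [st|ts] := totA s t As At.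
      * exists t => //; have /asboolP/(_ x) := st.
        by have := (svalP t).1.1 x y; lra.
      * exists s => //; have /asboolP/(_ y) := ts.
        by have := (svalP s).1.1 x y; lra.
    + by move=> a x s a0 As; exists s => //; exact: (svalP s).1.2.
  have ip x : inf [set sval s x | s in A] <= p x.
    have [s As] := A0; apply: le_trans (_ : sval s x <= _).
      by apply: ge_inf => //; exists s.
    exact: (svalP s).2.
  exists (exist _ (fun x => inf [set sval s x | s in A]) (conj si ip)) => s As.
  apply/asboolP => x /=.
  by apply: ge_inf => //; exists s.
- exists q; split => // q' sq' q'q.
  have q'p x : q' x <= p x by exact: le_trans (q'q x) (qp x).
  have := qmin (exist _ q' (conj sq' q'p)).
  by move=> /(_ _)/(congr1 sval)/= ->//; apply/asboolP.
Qed.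

(** A minimal sublinear functional equals its own tilts, hence is superadditive and so linear. No
    functional is extended from a subspace: a value to be attained is prescribed by tilting [p]
    beforehand. *)
Lemma hahn_banach p : sublinear p ->
  exists f : {linear X -> R^o}, forall x, f x <= p x.
Proof.
move=> /minimal_sublinear[q [sq qp qmin]].
have qD x y : q (x + y) = q x + q y.
  apply/eqP; rewrite eq_le sq.1/=.
  have tq : tilt q y = q.
    apply: qmin; first exact: sublinear_tilt.
    by move=> z; have := tilt_le sq z y 0 (lexx _); rewrite scale0r mul0r addr0 subr0.
  have := tilt_le sq x y 1 ler01.
  by rewrite tq scale1r mul1r lerBrDr.
have q0 : q 0 = 0 by have := sublinearZ sq 0 0 (lexx _); rewrite scale0r mul0r.
have qN x : q (- x) = - q x.
  by apply/eqP; rewrite -addr_eq0 -qD addNr q0.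
have qZ : scalable_for ( *:%R : R -> R^o -> R^o) q.
  move=> a x; have [a0|a0] := leP 0 a; first exact: sublinearZ.
  rewrite -[a]opprK scaleNr qN (sublinearZ sq) ?oppr_ge0 ?ltW//.
  by rewrite -scaleNr.
have qL : linear_for ( *:%R : R -> R^o -> R^o) q.
  by move=> a x y; rewrite qD qZ.
pose qb := GRing.isLinear.Build R X R^o *:%R q qL.
pose f : {linear X -> R^o} := HB.pack (q : X -> R^o) qb.
by exists f.
Qed.

End HahnBanach.

(** * Norming functionals and boundedness of weakly convergent sequences *)

Section WeakConvergence.
Context {R : realType} {X : normedModType R}.

(** Below the norm tilted along [z], a functional satisfies [f (- z) <=]|- z + z| -
    [|z| = -]|z|[, which forces]f z >= [|z|]. *)
Lemma norming_functional (z : X) :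
  exists f : {linear X -> R^o}, f z = `|z| /\ forall x, `|f x| <= `|x|.
Proof.
have sn : sublinear (fun x : X => `|x|).
  split=> [x y|a x a0]; first exact: ler_normD.
  by rewrite normrZ gtr0_norm.
have [f fp] := hahn_banach _ (sublinear_tilt sn z).
have fn x : f x <= `|x|.
  apply: le_trans (fp x) _; have := tilt_le sn x z 0 (lexx _).
  by rewrite scale0r mul0r addr0 subr0.
have fN x : `|f x| <= `|x|.
  by rewrite ler_norml fn andbT lerNl -linearN -(normrN x) fn.
exists f; split=> //; apply/eqP; rewrite eq_le fn/=.
have := le_trans (fp (- z)) (tilt_le sn (- z) z 1 ler01).
by rewrite scale1r addNr normr0 mul1r sub0r linearN lerN2.
Qed.

Lemma linear_bounded_by_continuous (f : {linear X -> R^o}) (C : R) :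
  (forall x, `|f x| <= C * `|x|) -> continuous f.
Proof.
move=> fC; apply/linear_bounded_continuous/linear_boundedP.
near=> r => x; apply: le_trans (fC x) _.
by apply: ler_wpM2r => //; near: r; exact: nbhs_pinfty_ge.
Unshelve. all: by end_near. Qed.


(* The functional is a series of terms [3^-k f_k] or [- 3^-k f_k], with [f_k]
   norming the k-th element of a rapidly growing subsequence; the sign is chosen
   so that the k-th term does not cancel against the previous ones, and the
   tail is half as large. *)
Lemma norm_unbounded_functional (v : nat -> X) :
  (forall C : R, exists n, C < `|v n|) ->
  exists f : {linear X -> R^o}, continuous f /\
    forall C : R, exists n, C < `|f (v n)|.
Proof.
move=> vub.
have /choice[m mP] : forall k : nat, exists n, 2 * k%:R * 3 ^+ k < `|v n|.
  by move=> k; exact: vub.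
pose y k := v (m k).
have /choice[F FP] : forall k : nat, exists f : {linear X -> R^o},
    f (y k) = `|y k| /\ forall x, `|f x| <= `|x|.
  by move=> k; exact: norming_functional.
(* [sg 0 = 1], so that no term is lost when the partial sum vanishes, as it does at [k = 0]. *)
pose sg (a : R) : R := if 0 <= a then 1 else -1.
pose G := fix G k : X -> R := if k is k'.+1 then
  (fun x => G k' x + sg (G k' (y k')) * 3^-1 ^+ k' * F k' x) else (fun=> 0).
have GS k x : G k.+1 x = G k x + sg (G k (y k)) * 3^-1 ^+ k * F k x by [].
have sg1 a : `|sg a| = 1 by rewrite /sg; case: ifP; rewrite ?normrN normr1.
have t0 k : 0 < (3^-1 : R) ^+ k by rewrite exprn_gt0// invr_gt0.
have Glin k (a : R) x z : G k (a *: x + z) = a * G k x + G k z.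
  elim: k => [|k IH]; first by rewrite /= mulr0 addr0.
  by rewrite !GS IH linearP /=; rewrite /GRing.scale/=; ring.
(* [3 / 2] is the sum of the geometric series of ratio [3^-1]. *)
have Gdist k l x : `|G (k + l)%N x - G k x| <=
    (3^-1 ^+ k - 3^-1 ^+ (k + l)) * (3 / 2) * `|x|.
  elim: l => [|l IH]; first by rewrite addn0 !subrr normr0 !mul0r.
  rewrite addnS GS addrAC; apply: (le_trans (ler_normD _ _)).
  apply: le_trans (lerD IH (_ : _ <= 3^-1 ^+ (k + l) * `|x|)) _.
    rewrite !normrM sg1 mul1r (gtr0_norm (t0 _)) ler_pM2l//.
    exact: (FP _).2.
  by rewrite exprS -mulrDl; apply: ler_wpM2r => //; lra.
have Gtail k l x : (k <= l)%N -> `|G l x - G k x| <= 3^-1 ^+ k * (3 / 2) * `|x|.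
  move=> /subnKC <-; apply: le_trans (Gdist _ _ _) _.
  by apply: ler_wpM2r => //; have := t0 (k + (l - k))%N; lra.
have Gcvg x : cvgn (G^~ x).
  apply: cauchy_cvg; apply: cauchy_exP => e e0.
  have /cvgrPdist_lt/(_ _ e0)[k _ /(_ k (leqnn k))] :
      geometric (3 / 2 * `|x|) (3^-1 : R) @ \oo --> 0.
    by apply: cvg_geometric; rewrite ger0_norm ?invr_ge0// invf_lt1 ?ltr1n.
  rewrite /= sub0r normrN ger0_norm; last first.
    by rewrite mulr_ge0 ?(ltW (t0 _))// mulr_ge0.
  move=> ke; exists (G k x); exists k => //= l kl.
  rewrite /ball/= distrC; apply: le_lt_trans (Gtail k l x kl) _.
  by rewrite -mulrA mulrC.
pose g x : R^o := limn (G^~ x).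
have gtail k x : `|g x - G k x| <= 3^-1 ^+ k * (3 / 2) * `|x|.
  have h : `|G l x - G k x| @[l --> \oo] --> `|g x - G k x|.
    by apply: cvg_norm; apply: cvgB; [exact: Gcvg|exact: cvg_cst].
  apply: (cvgr_to_le h).
  by exists k => //= l kl; exact: Gtail.
have glin : linear_for ( *:%R : R -> R^o -> R^o) g.
  move=> a x z; apply: cvg_lim => //.
  rewrite (_ : G^~ (a *: x + z) = (fun k => a *: (G k x : R^o) + G k z)).
    by apply: cvgD; [apply: cvgZl_tmp; exact: Gcvg|exact: Gcvg].
  by apply/funext => k; rewrite Glin.
pose gb := GRing.isLinear.Build R X R^o *:%R g glin.
pose f : {linear X -> R^o} := HB.pack (g : X -> R^o) gb.
have fE x : f x = g x by [].
exists f; split.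
  apply: (@linear_bounded_by_continuous _ (3 / 2)) => x.
  by have := gtail 0%N x; rewrite expr0 mul1r subr0.
move=> C; have [k Ck] : exists k : nat, C < k%:R.
  by exists (Num.truncn C).+1; exact: truncnS_gt.
exists (m k); apply: (lt_le_trans Ck); rewrite fE -/(y k).
have Gy : 3^-1 ^+ k * `|y k| <= `|G k.+1 (y k)|.
  rewrite GS (FP k).1 /sg; case: (leP 0 (G k (y k))) => Gk.
    by rewrite mul1r ler_normr lerDr Gk.
  by rewrite mulN1r mulNr ler_normr opprD opprK lerDr oppr_ge0 (ltW Gk) orbT.
have yk : k%:R <= 2^-1 * (3^-1 ^+ k * `|y k|).
  have := ltW (mP k); rewrite exprVn -/(y k) => h.
  by rewrite ler_pdivlMl// ler_pdivlMl ?exprn_gt0// mulrC.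
have := gtail k.+1 (y k); rewrite exprS.
have := ler_normB (g (y k)) (g (y k) - G k.+1 (y k)).
rewrite opprB addrC subrK => h1 h2.
move: (lerD h1 h2); lra.
Qed.

Lemma weakly_converges_bounded (v : nat -> X) (u : X) :
  weakly_converges v u -> exists C : R, forall n, `|v n| <= C.
Proof.
move=> vu; apply: contrapT => /forallNP vub.
have {}vub (C : R) : exists n, C < `|v n|.
  by have /existsNP[n /negP] := vub C; rewrite -ltNge; exists n.
have [f [fc fub]] := norm_unbounded_functional v vub.
have /pinfty_ex_gt0[M _ /= fM] := cvg_seq_bounded (cvgP _ (vu f fc)).
by have [n] := fub M; rewrite ltNge => /negP; apply; exact: fM.
Qed.

End WeakConvergence.

(** * Complex-valued L^p functions *)

Section ComplexMeasurable.
Context {d : measure_display} {T : measurableType d} {R : realType}.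
Implicit Types f g h : T -> R[i].

Definition measurable_cfun f : Prop :=
  measurable_fun setT (fun x => complex.Re (f x)) /\
  measurable_fun setT (fun x => complex.Im (f x)).

Lemma measurable_cfunB f g : measurable_cfun f -> measurable_cfun g ->
  measurable_cfun (fun x => f x - g x).
Proof.
move=> [fr fi] [gr gi]; split.
- rewrite (_ : (fun _ => _) = fun x => complex.Re (f x) - complex.Re (g x)).
    exact: measurable_funB.
  by apply/funext => x; case: (f x) (g x) => [? ?] [? ?].
- rewrite (_ : (fun _ => _) = fun x => complex.Im (f x) - complex.Im (g x)).
    exact: measurable_funB.
  by apply/funext => x; case: (f x) (g x) => [? ?] [? ?].
Qed.

Lemma measurable_normc f : measurable_cfun f ->
  measurable_fun setT (fun x => Normc.normc (f x)).
Proof.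
move=> [fr fi].
rewrite (_ : (fun _ => _) = fun x =>
    Num.sqrt (complex.Re (f x) ^+ 2 + complex.Im (f x) ^+ 2)).
  apply: (@measurableT_comp _ _ _ _ _ _ (@Num.sqrt R)).
    by apply: continuous_measurable_fun; exact: sqrt_continuous.
  by apply: measurable_funD; exact: measurable_funX.
by apply/funext => x; case: (f x).
Qed.

End ComplexMeasurable.

Lemma normc_ge0 {R : rcfType} (z : R[i]) : 0 <= Normc.normc z.
Proof. by case: z => a b; exact: sqrtr_ge0. Qed.

Lemma normcB {R : rcfType} (z w : R[i]) :
  Normc.normc (z - w) = Normc.normc (w - z).
Proof.
by case: z w => [a b] [c e] /=; rewrite -sqrrN opprB -[X in _ + X]sqrrN opprB.
Qed.

Lemma normcD {R : rcfType} (z w : R[i]) :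
  Normc.normc (z + w) <= Normc.normc z + Normc.normc w.
Proof. exact: (@le_normcD R). Qed.

Section Restriction.
Context {d : measure_display} {T : measurableType d} {R : realType}.
Variables (mu : {measure set T -> \bar R}) (D : set T) (mD : measurable D).

Lemma ge0_integral_mrestr (f : T -> \bar R) : (forall x, 0 <= f x)%E ->
  measurable_fun setT f ->
  (\int[mrestr mu mD]_x f x = \int[mu]_(x in D) f x)%E.
Proof.
move=> f0 mf; have mCD := measurableC mD.
rewrite -(setUv D) ge0_integral_setU//; last 2 first.
- by rewrite setUv.
- exact/disj_setPCl.
rewrite (_ : (\int[_]_(x in ~` D) _ = 0)%E) ?adde0.
  by apply: eq_measure_integral => A mA AD; rewrite /= /mrestr setIidl.
apply/eqP; rewrite eq_le; apply/andP; split; last exact: integral_ge0.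
rewrite (@eq_measure_integral _ _ _ _ mzero) ?integral_measure_zero// => A mA AD.
rewrite /= /mrestr (_ : A `&` D = set0) ?measure0//.
by apply/disjoints_subset.
Qed.

Lemma ae_mrestr {S : Type} (f g : T -> S) :
  f = g %[ae mu] -> f = g %[ae mrestr mu mD].
Proof.
move=> [A [mA A0 fgA]]; exists A; split => //.
apply/eqP; rewrite eq_le measure_ge0 andbT -A0.
by apply: le_measure => //; rewrite inE//; exact: measurableI.
Qed.

End Restriction.

Section LpNorm.
Context {d : measure_display} {T : measurableType d} {R : realType}.
Variables (mu : {measure set T -> \bar R}) (p : R) (p1 : 1 <= p).
Implicit Types f g h : T -> R[i].

Let p0 : 0 < p := lt_le_trans ltr01 p1.
Let pn0 : p != 0 := lt0r_neq0 p0.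

Lemma Lp_norm_poweR f :
  poweR (Lp_norm mu p f) p = (\int[mu]_x (Normc.normc (f x) `^ p)%:E)%E.
Proof.
rewrite (poweR_Lnorm _ _ pn0); apply: eq_integral => x _.
by rewrite abse_EFin ger0_norm ?normc_ge0// poweR_EFin.
Qed.

Lemma measurable_normc_powR f : measurable_cfun f ->
  measurable_fun setT (fun x => (Normc.normc (f x) `^ p)%:E).
Proof.
move=> mf; apply/measurable_EFinP.
apply: (@measurableT_comp _ _ _ _ _ _ (@powR R ^~ p)) => //.
exact: measurable_normc.
Qed.

(** Norms are compared through their [p]-th powers, which are plain integrals even when infinite;
    this is the way back. *)
Lemma poweR_le_inv (x y : \bar R) : (0 <= x)%E -> (0 <= y)%E ->
  (x `^ p <= y `^ p)%E -> (x <= y)%E.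
Proof.
move=> x0 y0 xy; rewrite -(poweRe1 x0) -(poweRe1 y0) -(mulfV pn0).
by rewrite !poweRrM gt0_ler_poweR ?invr_ge0 ?(ltW p0)//
  in_itv/= poweR_ge0 leey.
Qed.

Lemma le_Lp_norm (f g : T -> R) : measurable_fun setT f ->
  measurable_fun setT g -> (forall x, 0 <= f x <= g x) ->
  (Lnorm mu p%:E (EFin \o f) <= Lnorm mu p%:E (EFin \o g))%E.
Proof.
move=> mf mg fg; apply: poweR_le_inv; [exact: Lnorm_ge0|exact: Lnorm_ge0|].
rewrite !(poweR_Lnorm _ _ pn0); apply: ge0_le_integral => //=.
- by apply/measurable_EFinP; apply: (@measurableT_comp _ _ _ _ _ _ (@powR R ^~ p));
    [exact: measurable_powR|exact: measurableT_comp].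
- by apply/measurable_EFinP; apply: (@measurableT_comp _ _ _ _ _ _ (@powR R ^~ p));
    [exact: measurable_powR|exact: measurableT_comp].
- move=> x _; have /andP[f0 fg'] := fg x; have g0 := le_trans f0 fg'.
  by rewrite lee_fin !ger0_norm// ge0_ler_powR ?(ltW p0).
Qed.

Lemma Lp_norm_triangle f g h : measurable_cfun f -> measurable_cfun g ->
  measurable_cfun h ->
  (Lp_norm mu p (fun x => f x - h x)%R
   <= Lp_norm mu p (fun x => f x - g x)%R +
      Lp_norm mu p (fun x => g x - h x)%R)%E.
Proof.
move=> mf mg mh.
have mfg := measurable_normc _ (measurable_cfunB _ _ mf mg).
have mgh := measurable_normc _ (measurable_cfunB _ _ mg mh).
have mfh := measurable_normc _ (measurable_cfunB _ _ mf mh).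
apply: le_trans (minkowski_EFin _ mfg mgh p1).
apply: le_Lp_norm => //; first exact: measurable_funD.
move=> x; rewrite normc_ge0/= (_ : f x - h x = f x - g x + (g x - h x)).
  exact: normcD.
by rewrite addrA subrK.
Qed.

Lemma Lp_normB f g :
  Lp_norm mu p (fun x => f x - g x) = Lp_norm mu p (fun x => g x - f x).
Proof. by apply: eq_Lnorm => x; rewrite normcB. Qed.

Lemma Lp_norm_sub0 f : Lp_norm mu p (fun x => f x - 0) = Lp_norm mu p f.
Proof. by apply: eq_Lnorm => x; rewrite subr0. Qed.

Lemma measurable_cfun0 : measurable_cfun ((fun=> 0) : T -> R[i]).
Proof. by split; exact: measurable_cst. Qed.

Lemma Lp_norm_le_add f g : measurable_cfun f -> measurable_cfun g ->
  (Lp_norm mu p f <= Lp_norm mu p (fun x => f x - g x)%R + Lp_norm mu p g)%E.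
Proof.
move=> mf mg; have := Lp_norm_triangle _ _ _ mf mg measurable_cfun0.
by rewrite (Lp_norm_sub0 f) (Lp_norm_sub0 g).
Qed.

Lemma Lp_norm_sub_le f g : measurable_cfun f -> measurable_cfun g ->
  (Lp_norm mu p (fun x => f x - g x)%R <= Lp_norm mu p f + Lp_norm mu p g)%E.
Proof.
move=> mf mg; have := Lp_norm_triangle _ _ _ mf measurable_cfun0 mg.
by rewrite (Lp_norm_sub0 f) (Lp_normB (fun=> 0) g) (Lp_norm_sub0 g).
Qed.

Lemma Lp_norm_ae f g : measurable_cfun f -> measurable_cfun g ->
  f = g %[ae mu] -> Lp_norm mu p f = Lp_norm mu p g.
Proof.
move=> mf mg fg; apply/eqP; rewrite eq_le.
have e : poweR (Lp_norm mu p f) p = poweR (Lp_norm mu p g) p.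
  rewrite !Lp_norm_poweR; apply: ae_eq_integral => //.
  - exact: measurable_normc_powR.
  - exact: measurable_normc_powR.
  - by apply: filterS fg => x /= /(_ I) -> _.
by apply/andP; split;
  (apply: poweR_le_inv; [exact: Lnorm_ge0|exact: Lnorm_ge0|rewrite e]).
Qed.

Lemma in_LpB f g : in_Lp mu p f -> in_Lp mu p g ->
  in_Lp mu p (fun x => f x - g x).
Proof.
move=> [fr fi foo] [gr gi goo].
have [] := measurable_cfunB _ _ (conj fr fi) (conj gr gi); split => //.
apply: le_lt_trans (Lp_norm_sub_le _ _ (conj fr fi) (conj gr gi)) _.
exact: lte_add_pinfty.
Qed.

Lemma in_Lp_measurable f : in_Lp mu p f -> measurable_cfun f.
Proof. by case. Qed.

(* Real-valued version of [Lp_norm], which is [0] when the norm is infinite. *)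
Definition rLp_norm f : R := fine (Lp_norm mu p f).

Lemma rLp_normE f : in_Lp mu p f -> Lp_norm mu p f = (rLp_norm f)%:E.
Proof. by move=> [_ _ foo]; rewrite fineK// ge0_fin_numE ?Lnorm_ge0. Qed.

Lemma rLp_norm_ge0 f : 0 <= rLp_norm f.
Proof. exact/fine_ge0/Lnorm_ge0. Qed.

Lemma rLp_norm_le_add f g : in_Lp mu p f -> in_Lp mu p g ->
  rLp_norm f <= rLp_norm (fun x => f x - g x) + rLp_norm g.
Proof.
move=> Lf Lg; have Lfg := in_LpB _ _ Lf Lg.
rewrite -lee_fin EFinD -!rLp_normE//.
by apply: Lp_norm_le_add; exact: in_Lp_measurable.
Qed.

Lemma rLp_norm_sub_le f g : in_Lp mu p f -> in_Lp mu p g ->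
  rLp_norm (fun x => f x - g x) <= rLp_norm f + rLp_norm g.
Proof.
move=> Lf Lg; have Lfg := in_LpB _ _ Lf Lg.
rewrite -lee_fin EFinD -!rLp_normE//.
by apply: Lp_norm_sub_le; exact: in_Lp_measurable.
Qed.

Lemma rLp_normB f g :
  rLp_norm (fun x => f x - g x) = rLp_norm (fun x => g x - f x).
Proof. by rewrite /rLp_norm Lp_normB. Qed.

Lemma rLp_norm_dist f g : in_Lp mu p f -> in_Lp mu p g ->
  `|rLp_norm f - rLp_norm g| <= rLp_norm (fun x => f x - g x).
Proof.
move=> Lf Lg; rewrite ler_norml.
have := rLp_norm_le_add _ _ Lf Lg; have := rLp_norm_le_add _ _ Lg Lf.
by rewrite rLp_normB => h1 h2; apply/andP; split; lra.
Qed.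

Lemma rLp_norm_powR f : in_Lp mu p f ->
  (rLp_norm f `^ p)%:E = (\int[mu]_x (Normc.normc (f x) `^ p)%:E)%E.
Proof. by move=> Lf; rewrite -Lp_norm_poweR rLp_normE// poweR_EFin. Qed.

End LpNorm.

(** * Lipschitz bound for powers and splitting of norms *)

Section PowerLipschitz.
Context {R : realType}.

(** Bernoulli's inequality, which replaces the mean value theorem in the next lemma. *)
Lemma expr_ge_tangent (r : R) (m : nat) : 0 <= r <= 1 ->
  1 - m%:R * (1 - r) <= r ^+ m.
Proof.
move=> /andP[r0 r1]; elim: m => [|m IH]; first by rewrite mul0r subr0.
have h : 0 <= r * (r ^+ m - (1 - m%:R * (1 - r))) by rewrite mulr_ge0// subr_ge0.
have h' : 0 <= m%:R * (1 - r) * (1 - r).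
  by rewrite -mulrA mulr_ge0// mulr_ge0// subr_ge0.
by rewrite exprS -natr1; nra.
Qed.

Lemma powR_lipschitz (p Q : R) : 1 <= p -> 0 <= Q ->
  exists L : R, 0 <= L /\ forall x y : R, 0 <= x <= Q -> 0 <= y <= Q ->
    `|x `^ p - y `^ p| <= L * `|x - y|.
Proof.
move=> p1 Q0; have p0 : 0 < p by exact: lt_le_trans p1.
pose m := (Num.truncn p).+1; exists (m%:R * Q `^ (p - 1)).
have L0 : 0 <= m%:R * Q `^ (p - 1) by rewrite mulr_ge0// powR_ge0.
split=> // x y hx hy.
wlog yx : x y hx hy / y <= x.
  move=> H; have [|/ltW xy] := leP y x; first exact: H.
  by rewrite distrC (distrC x); exact: H.
move: hx hy => /andP[x0 xQ] /andP[y0 yQ].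
have yxp : y `^ p <= x `^ p by rewrite ge0_ler_powR// ?nnegrE// ltW.
rewrite !ger0_norm ?subr_ge0//.
have [->|yn0] := eqVneq y 0.
  rewrite powR0 ?gt_eqF// !subr0 -(mulr_powRB1 x0 p0) mulrC.
  apply: ler_wpM2r => //.
  apply: le_trans (_ : Q `^ (p - 1) <= _).
    by rewrite ge0_ler_powR// ?nnegrE// subr_ge0.
  by rewrite ler_peMl ?powR_ge0// ler1n.
have {}y0 : 0 < y by rewrite lt_neqAle eq_sym yn0.
have {}x0 : 0 < x by exact: lt_le_trans yx.
pose r := y / x.
have r01 : 0 <= r <= 1.
  by rewrite divr_ge0 ?(ltW y0) ?(ltW x0)//= ler_pdivrMr// mul1r.
have r0 : 0 < r by rewrite divr_gt0.
have yE : y = r * x by rewrite divfK// gt_eqF.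
have rp : 1 - m%:R * (1 - r) <= r `^ p.
  apply: le_trans (expr_ge_tangent r m r01) _.
  rewrite -powR_mulrn ?(ltW r0)//; apply: ger_powR.
    by rewrite r0/=; case/andP: r01.
  exact/ltW/truncnS_gt.
rewrite yE powRM ?(ltW r0) ?(ltW x0)// -{1}[x `^ p]mul1r -mulrBl.
apply: le_trans (_ : m%:R * (1 - r) * x `^ p <= _).
  by apply: ler_wpM2r; [exact: powR_ge0|lra].
rewrite -(mulr_powRB1 (ltW x0) p0) (_ : x - r * x = (1 - r) * x); last by ring.
have r1 : 0 <= 1 - r by rewrite subr_ge0; case/andP: r01.
rewrite (_ : _ * (x * _) = (1 - r) * x * (m%:R * x `^ (p - 1))); last by ring.
rewrite [leRHS]mulrC; apply: ler_wpM2l; first by rewrite mulr_ge0// ltW.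
by apply: ler_wpM2l => //; rewrite ge0_ler_powR// ?nnegrE ?subr_ge0// ltW.
Qed.

(** The arithmetic of the Brezis-Lieb splitting: [A, A', a] are the norms of [v n], [v n - u], [u]
    on a large set and [B, B', b] those off it. Each of the four pairs compared costs [L * eps]. *)
Lemma split_estimate (P : R -> R) (L eps A B A' B' a b : R) : P 0 = 0 ->
  `|P A' - P 0| <= L * `|A' - 0| -> `|P B' - P B| <= L * `|B' - B| ->
  `|P A - P a| <= L * `|A - a| -> `|P b - P 0| <= L * `|b - 0| ->
  `|A' - 0| <= eps -> `|B' - B| <= eps -> `|A - a| <= eps -> `|b - 0| <= eps ->
  0 <= L -> `|P A + P B - (P a + P b) - (P A' + P B')| <= 4 * (L * eps).
Proof.
move=> -> h1 h2 h3 h4 e1 e2 e3 e4 L0.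
have := le_trans h1 (ler_wpM2l L0 e1); have := le_trans h2 (ler_wpM2l L0 e2).
have := le_trans h3 (ler_wpM2l L0 e3); have := le_trans h4 (ler_wpM2l L0 e4).
rewrite !ler_norml => /andP[? ?] /andP[? ?] /andP[? ?] /andP[? ?].
by apply/andP; split; lra.
Qed.

End PowerLipschitz.

Section Splitting.
Context {d : measure_display} {T : measurableType d} {R : realType}.
Variables (mu : {measure set T -> \bar R}) (p : R) (p1 : 1 <= p).
Implicit Types f g : T -> R[i].

Let p0 : 0 < p := lt_le_trans ltr01 p1.

Lemma poweR_Lp_norm_mrestr (D : set T) (mD : measurable D) f :
  measurable_cfun f ->
  poweR (Lp_norm (mrestr mu mD) p f) p =
    (\int[mu]_(x in D) (Normc.normc (f x) `^ p)%:E)%E.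
Proof.
move=> mf; rewrite Lp_norm_poweR//; apply: ge0_integral_mrestr.
  by move=> x; rewrite lee_fin powR_ge0.
exact: measurable_normc_powR.
Qed.

Lemma Lp_norm_mrestr_le (D : set T) (mD : measurable D) f :
  measurable_cfun f -> (Lp_norm (mrestr mu mD) p f <= Lp_norm mu p f)%E.
Proof.
move=> mf; apply: (poweR_le_inv p p1); [exact: Lnorm_ge0|exact: Lnorm_ge0|].
rewrite poweR_Lp_norm_mrestr// Lp_norm_poweR//.
apply: ge0_subset_integral => //.
- exact: measurable_normc_powR.
- by move=> x _; rewrite lee_fin powR_ge0.
Qed.

Lemma in_Lp_mrestr (D : set T) (mD : measurable D) f :
  in_Lp mu p f -> in_Lp (mrestr mu mD) p f.
Proof.
move=> [fr fi foo]; split => //; apply: le_lt_trans foo.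
exact: Lp_norm_mrestr_le.
Qed.

Lemma rLp_norm_mrestr_le (D : set T) (mD : measurable D) f :
  in_Lp mu p f -> rLp_norm (mrestr mu mD) p f <= rLp_norm mu p f.
Proof.
move=> Lf; have Lf' := in_Lp_mrestr D mD f Lf; rewrite -lee_fin -!rLp_normE//.
by apply: Lp_norm_mrestr_le; exact: in_Lp_measurable Lf.
Qed.

Lemma rLp_norm_split (D : set T) (mD : measurable D) f : in_Lp mu p f ->
  rLp_norm mu p f `^ p = rLp_norm (mrestr mu mD) p f `^ p +
    rLp_norm (mrestr mu (measurableC mD)) p f `^ p.
Proof.
move=> Lf; have [fr fi _] := Lf.
apply: EFin_inj; rewrite EFinD !rLp_norm_powR//; try exact: in_Lp_mrestr.
have f0 x : (0 <= (Normc.normc (f x) `^ p)%:E)%E by rewrite lee_fin powR_ge0.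
have mf := measurable_normc_powR p f (conj fr fi).
rewrite !ge0_integral_mrestr// -{1}(setUv D) ge0_integral_setU//.
- exact: measurableC.
- by rewrite setUv.
- exact/disj_setPCl.
Qed.

(** By monotone convergence the integrals over [K k] increase to the full one, and the tail is the
    difference. *)
Lemma rLp_norm_tail (K : nat -> set T) (mK : forall k, measurable (K k)) f :
  nondecreasing_seq K -> \bigcup_k K k = setT -> in_Lp mu p f ->
  forall e : R, 0 < e -> exists k,
    rLp_norm (mrestr mu (measurableC (mK k))) p f < e.
Proof.
move=> ndK UK Lf e e0; have [fr fi _] := Lf.
have f0 x : (0 <= (Normc.normc (f x) `^ p)%:E)%E by rewrite lee_fin powR_ge0.
have mf := measurable_normc_powR p f (conj fr fi).
have := @ge0_nondecreasing_set_cvg_integral _ _ _ K _ mu ndK mK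
  (fun i => measurable_funTS mf) (fun i x _ => f0 x).
rewrite UK -(rLp_norm_powR _ _ p1)// (_ : (fun _ => _) =
    fun k => (rLp_norm (mrestr mu (mK k)) p f `^ p)%:E); last first.
  apply/funext => k; rewrite -ge0_integral_mrestr//.
  by rewrite -rLp_norm_powR//; exact: in_Lp_mrestr.
move=> /fine_cvgP[_ /cvgrPdist_lt/(_ _ (powR_gt0 p e0))[k _ /(_ k (leqnn k))]].
rewrite /= (rLp_norm_split _ (mK k))// addrAC subrr add0r.
rewrite ger0_norm ?powR_ge0// => h; exists k; rewrite ltNge; apply/negP => h'.
by move: h; rewrite ltNge ge0_ler_powR// ?nnegrE ?(ltW p0) ?(ltW e0)// rLp_norm_ge0.
Qed.

(* Brezis-Lieb identity under local strong convergence: outside a large set [u]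
   is negligible and inside it [v n - u] is, so the norms split without any
   passage to an almost everywhere convergent subsequence. *)
Lemma brezis_lieb (K : nat -> set T) (mK : forall k, measurable (K k))
    (v : nat -> T -> R[i]) (u : T -> R[i]) (c : R) :
  nondecreasing_seq K -> \bigcup_k K k = setT ->
  (forall n, in_Lp mu p (v n)) -> in_Lp mu p u ->
  (forall n, rLp_norm mu p (v n) `^ p = c) ->
  (forall k, rLp_norm (mrestr mu (mK k)) p (fun x => v n x - u x) @[n --> \oo]
     --> 0) ->
  rLp_norm mu p (fun x => v n x - u x) `^ p @[n --> \oo]
    --> c - rLp_norm mu p u `^ p.
Proof.
move=> ndK UK Lv Lu vc vu.
have Lvu n : in_Lp mu p (fun x => v n x - u x) by exact: in_LpB.
pose N := rLp_norm mu p (v 0%N).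
have vN n : rLp_norm mu p (v n) = N.
  apply: (powR_injective p0); rewrite ?nnegrE ?rLp_norm_ge0//.
  by rewrite !vc.
(* A common bound for every norm that occurs, on any measurable set, so that one Lipschitz constant
   serves all of them. *)
pose Q := N + rLp_norm mu p u.
have N0 : 0 <= N by exact: rLp_norm_ge0.
have u0 : 0 <= rLp_norm mu p u by exact: rLp_norm_ge0.
have Q0 : 0 <= Q by exact: addr_ge0.
have [L [L0 LQ]] := powR_lipschitz _ _ p1 Q0.
have NQ (D : set T) (mD : measurable D) n :
    0 <= rLp_norm (mrestr mu mD) p (v n) <= Q.
  rewrite rLp_norm_ge0/=; apply: le_trans (rLp_norm_mrestr_le _ mD _ (Lv n)) _.
  by rewrite vN lerDl.
have NuQ (D : set T) (mD : measurable D) :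
    0 <= rLp_norm (mrestr mu mD) p u <= Q.
  rewrite rLp_norm_ge0/=; apply: le_trans (rLp_norm_mrestr_le _ mD _ Lu) _.
  by rewrite lerDr.
have NvuQ (D : set T) (mD : measurable D) n :
    0 <= rLp_norm (mrestr mu mD) p (fun x => v n x - u x) <= Q.
  rewrite rLp_norm_ge0/=; apply: le_trans (rLp_norm_mrestr_le _ mD _ (Lvu n)) _.
  by rewrite /Q -(vN n); exact: rLp_norm_sub_le.
apply/cvgrPdist_le => e e0.
(* Four errors of size [L * eps]; [L + 1] guards against [L = 0]. *)
pose eps := e / (4 * (L + 1)).
have L10 : 0 < L + 1 by rewrite ltr_wpDl.
have eps0 : 0 < eps by rewrite divr_gt0// mulr_gt0.
have Leps : 4 * (L * eps) <= e.
  have -> : e = 4 * ((L + 1) * eps) by rewrite /eps; field; rewrite gt_eqF.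
  by rewrite ler_pM2l// ler_wpM2r ?(ltW eps0)// lerDl.
have [k ku] := rLp_norm_tail K mK u ndK UK Lu eps eps0.
near=> n.
have vueps : rLp_norm (mrestr mu (mK k)) p (fun x => v n x - u x) <= eps.
  have : `|0 - rLp_norm (mrestr mu (mK k)) p (fun x => v n x - u x)| <= eps.
    by near: n; have /cvgrPdist_le := vu k; apply.
  by rewrite sub0r normrN ger0_norm// rLp_norm_ge0.
have Q00 : 0 <= (0 : R) <= Q by rewrite lexx.
rewrite -(vc n) !(rLp_norm_split _ (mK k))//.
apply: le_trans Leps; apply: (split_estimate (fun t => t `^ p)).
- by rewrite powR0// gt_eqF.
- exact: LQ _ _ (NvuQ _ (mK k) n) Q00.
- exact: LQ _ _ (NvuQ _ (measurableC (mK k)) n) (NQ _ (measurableC (mK k)) n).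
- exact: LQ _ _ (NQ _ (mK k) n) (NuQ _ (mK k)).
- exact: LQ _ _ (NuQ _ (measurableC (mK k))) Q00.
- by rewrite subr0 ger0_norm// rLp_norm_ge0.
- rewrite distrC; apply: le_trans (rLp_norm_dist _ _ _ _ _ _ _) _ => //.
  + exact: in_Lp_mrestr.
  + exact: in_Lp_mrestr.
  rewrite (_ : (fun x => _) = u) ?(ltW ku)//.
  by apply/funext => x; rewrite subKr.
- apply: le_trans vueps; apply: rLp_norm_dist => //; exact: in_Lp_mrestr.
- by rewrite subr0 ger0_norm ?(ltW ku)// rLp_norm_ge0.
- exact: L0.
Unshelve. all: by end_near. Qed.

End Splitting.

(** * Weak limits *)

Section CoordinateFunctionals.
Context {d : measure_display} {T : measurableType d} {R : realType}.
Variables (mu : {measure set T -> \bar R}) (p : R) (p1 : 1 < p).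
Implicit Types f g : T -> R[i].

Let p0 : 0 < p := lt_trans ltr01 p1.

(** [b] picks the real or imaginary part and [s] its sign. With both signs available, [z = 0]
    follows from four one-sided bounds, so superlevel sets are enough. *)
Definition cpart (b s : bool) (z : R[i]) : R :=
  (-1) ^+ s * (if b then complex.Re z else complex.Im z).

Lemma cpart_linear b s (a : R) (z w : R[i]) :
  cpart b s (a%:C%C * z + w) = a * cpart b s z + cpart b s w.
Proof. by case: z w => [z1 z2] [w1 w2]; case: b; rewrite /cpart/=; ring. Qed.

Lemma cpartB b s (z w : R[i]) : cpart b s (z - w) = cpart b s z - cpart b s w.
Proof. by case: z w => [z1 z2] [w1 w2]; case: b; rewrite /cpart/=; ring. Qed.

Lemma cpart_le_normc b s (z : R[i]) : `|cpart b s z| <= Normc.normc z.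
Proof.
rewrite /cpart normrM normrX normrN normr1 expr1n mul1r.
by case: z => x y /=; case: b; rewrite -sqrtr_sqr ler_wsqrtr// ?lerDl ?lerDr sqr_ge0.
Qed.

Lemma cpart_le0_eq0 (z : R[i]) : (forall b s, cpart b s z <= 0) -> z = 0.
Proof.
case: z => x y h.
have := h true true; have := h true false.
have := h false true; have := h false false.
rewrite /cpart/= expr0 expr1 => h1 h2 h3 h4.
by apply/eqP; rewrite eq_complex/=; apply/andP; split; apply/eqP; lra.
Qed.

Lemma measurable_cpart b s f : measurable_cfun f ->
  measurable_fun setT (fun x => cpart b s (f x)).
Proof. by move=> [fr fi]; apply: measurable_funM => //; case: b. Qed.

(** Hölder's inequality against the indicator of [A], with conjugate exponent [q = p / (p - 1)]; the
    constant is the [L^q] norm of the indicator. *)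
Lemma integral_normc_le (A : set T) : measurable A -> (mu A < +oo)%E ->
  exists C : R, 0 <= C /\ forall f, in_Lp mu p f ->
    (\int[mu]_(x in A) (Normc.normc (f x))%:E <= (C * rLp_norm mu p f)%:E)%E.
Proof.
move=> mA Aoo; pose q := p / (p - 1).
have pB : 0 < p - 1 by rewrite subr_gt0.
have q0 : 0 < q by rewrite divr_gt0.
have pq : p^-1 + q^-1 = 1 by rewrite /q; field; rewrite !gt_eqF.
pose N := Lnorm mu q%:E (EFin \o (\1_A : T -> R)).
have Nfin : N \is a fin_num.
  rewrite ge0_fin_numE ?Lnorm_ge0//; apply: (@lty_poweRy _ _ q).
    by rewrite gt_eqF.
  rewrite poweR_Lnorm ?gt_eqF//; apply: le_lt_trans Aoo.
  rewrite -[X in (_ <= mu X)%E](setIT) -integral_indic// le_eqVlt.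
  apply/orP; left; apply/eqP; apply: eq_integral => x _ /=.
  rewrite indicE; case: (x \in A); last by rewrite normr0 powR0 ?gt_eqF.
  by rewrite normr1 powR1.
exists (fine N); split; first exact/fine_ge0/Lnorm_ge0.
move=> f Lf; rewrite EFinM fineK// muleC -rLp_normE//.
have mf := measurable_normc f (in_Lp_measurable _ _ _ Lf).
have := hoelder mu mf (measurable_indic mA) p0 q0 pq.
apply: le_trans; rewrite Lnorm1 integral_mkcond le_eqVlt; apply/orP; left.
apply/eqP; apply: eq_integral => x _.
rewrite patchE /= indicE; case: ifPn => xA; last by rewrite mulr0 normr0.
by rewrite mulr1 ger0_norm ?normc_ge0.
Qed.

Lemma integrable_cpart b s (A : set T) f : measurable A -> (mu A < +oo)%E ->
  in_Lp mu p f -> mu.-integrable A (EFin \o (fun x => cpart b s (f x))).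
Proof.
move=> mA Aoo Lf; have mf := in_Lp_measurable _ _ _ Lf.
apply/integrableP; split.
  by apply/measurable_EFinP; apply: measurable_funTS; exact: measurable_cpart.
have [C [C0 HC]] := integral_normc_le A mA Aoo.
apply: le_lt_trans (_ : _ <= (C * rLp_norm mu p f)%:E)%E _; last by rewrite ltry.
apply: le_trans (HC f Lf).
apply: ge0_le_integral => //=.
- apply/measurable_EFinP; apply: measurable_funTS; apply: measurableT_comp => //.
  exact: measurable_cpart.
- by apply/measurable_EFinP; apply: measurable_funTS; exact: measurable_normc.
- by move=> x _; rewrite lee_fin cpart_le_normc.
Qed.

Lemma Rintegral_cpart_bound b s (A : set T) : measurable A -> (mu A < +oo)%E ->
  exists C : R, 0 <= C /\ forall f, in_Lp mu p f ->
    `|Rintegral mu A (fun x => cpart b s (f x))| <= C * rLp_norm mu p f.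
Proof.
move=> mA Aoo; have [C [C0 HC]] := integral_normc_le A mA Aoo.
exists C; split => // f Lf; have mf := in_Lp_measurable _ _ _ Lf.
have If := integrable_cpart b s A f mA Aoo Lf.
apply: le_trans (le_normr_Rintegral mA If) _.
rewrite -lee_fin fineK; last first.
  by apply: integrable_fin_num => //; exact: integrable_norm.
apply: le_trans (HC f Lf).
apply: ge0_le_integral => //=.
- apply/measurable_EFinP; apply: measurable_funTS; apply: measurableT_comp => //.
  exact: measurable_cpart.
- by apply/measurable_EFinP; apply: measurable_funTS; exact: measurable_normc.
- by move=> x _; rewrite lee_fin cpart_le_normc.
Qed.

Lemma measurable_superlevel b s f (e : R) : measurable_cfun f ->
  measurable [set x | e < cpart b s (f x)].
Proof.
move=> mf; rewrite -[X in measurable X]setTI.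
rewrite (_ : [set x | _] = (fun x => cpart b s (f x)) @^-1` `]e, +oo[%classic).
  by apply: measurable_cpart.
by apply/seteqP; split => x /=; rewrite in_itv/= andbT.
Qed.

(** Markov's inequality for [Normc.normc f]^ p[at level]e [^ p]. *)
Lemma Lp_superlevel_finite b s f (e : R) : in_Lp mu p f -> 0 < e ->
  (mu [set x | (e < cpart b s (f x))%R] < +oo)%E.
Proof.
move=> Lf e0; have mf := in_Lp_measurable _ _ _ Lf.
have ep0 : 0 < e `^ p by exact: powR_gt0.
have mfp := measurable_normc_powR p f mf.
have h := le_integral_abse mu measurableT mfp ep0.
have mS := measurable_superlevel b s f e mf.
apply: (@le_lt_trans _ _ (mu [set x |
    ((e `^ p)%:E <= `|(Normc.normc (f x) `^ p)%:E|)%E])).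
  apply: le_measure; rewrite ?inE//.
    rewrite -[X in measurable X]setTI; apply: emeasurable_fun_c_infty => //.
    exact: measurableT_comp.
  move=> x /= ex; rewrite lee_fin ger0_norm ?powR_ge0//.
  apply: ge0_ler_powR; rewrite ?nnegrE ?(ltW p0) ?(ltW e0) ?normc_ge0//.
  by apply: le_trans (ltW ex) _; apply: le_trans (ler_norm _) (cpart_le_normc _ _ _).
rewrite -[X in mu X]setTI -(@lte_pmul2l _ (e `^ p)%:E)// mulry.
rewrite gtr0_sg// mul1e; apply: le_lt_trans h _.
under eq_integral do rewrite /= ger0_norm ?powR_ge0//.
by rewrite -(rLp_norm_powR _ _ (ltW p1))// ltry.
Qed.

End CoordinateFunctionals.

Section WeakLimit.
Context {d : measure_display} {T : measurableType d} {R : realType}.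
Variables (mu : {measure set T -> \bar R}) (p : R) (p1 : 1 < p).
Context {X : normedModType R} (iota : X -> T -> R[i]).
Hypothesis iotaLp : forall u, in_Lp mu p (iota u).
Hypothesis iota_linear : forall (a : R) (u v : X),
  iota (a *: u + v) = (fun x => a%:C%C * iota u x + iota v x) %[ae mu].
Hypothesis iota_bounded :
  exists C : R, forall u, rLp_norm mu p (iota u) <= C * `|u|.

(** [iota] is linear only almost everywhere, which integrals do not see; continuity combines the
    Hölder bound on [A] with the imbedding constant. *)
Lemma cpart_functional b s (A : set T) : measurable A -> (mu A < +oo)%E ->
  exists F : {linear X -> R^o}, continuous F /\
    forall u, F u = Rintegral mu A (fun x => cpart b s (iota u x)).
Proof.
move=> mA Aoo.
pose F u : R^o := Rintegral mu A (fun x => cpart b s (iota u x)).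
have iF u := integrable_cpart mu p p1 b s A (iota u) mA Aoo (iotaLp u).
have Flin : linear_for ( *:%R : R -> R^o -> R^o) F.
  move=> a u v; rewrite /F /GRing.scale/=.
  rewrite -RintegralZl// -RintegralD//; last first.
    by have := integrableZl mA a (iF u).
  congr fine; apply: ae_eq_integral => //.
  - exact: measurable_int (iF _).
  - apply/measurable_EFinP; apply: measurable_funD.
      apply: measurable_funM => //.
      exact/measurable_EFinP/(measurable_int mu (iF u)).
    exact/measurable_EFinP/(measurable_int mu (iF v)).
  - apply: filterS (iota_linear a u v) => x /= /(_ I) -> _.
    by rewrite cpart_linear.
pose Fb := GRing.isLinear.Build R X R^o *:%R F Flin.
pose f : {linear X -> R^o} := HB.pack (F : X -> R^o) Fb.
exists f; split => //.
have [C [C0 HC]] := Rintegral_cpart_bound mu p p1 b s A mA Aoo.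
have [D HD] := iota_bounded.
apply: (linear_bounded_by_continuous _ (C * D)) => u.
apply: le_trans (HC _ (iotaLp u)) _.
by rewrite -mulrA; apply: ler_wpM2l.
Qed.

(* For [A] of finite measure, integrating a real part of [iota _] over [A] is a
   continuous functional on [X], so the parts of [g] and [iota u] have the same
   integral over [A]. On [A = {cpart b s (g - iota u) > e}] this gives
   [e * mu A <= 0]. *)
Lemma weak_limit_unique (w : nat -> X) (u : X) (g : T -> R[i]) :
  weakly_converges w u -> in_Lp mu p g ->
  rLp_norm mu p (fun x => iota (w n) x - g x) @[n --> \oo] --> 0 ->
  g = iota u %[ae mu].
Proof.
move=> wu Lg wg; pose h x := g x - iota u x.
have Lh : in_Lp mu p h by exact: in_LpB (ltW p1) _ _ Lg (iotaLp u).
have h0 b s (e : R) : 0 < e -> mu [set x | e < cpart b s (h x)] = 0.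
  move=> e0; set A := [set x | _].
  have mA : measurable A.
    exact: measurable_superlevel (in_Lp_measurable _ _ _ Lh).
  have Aoo : (mu A < +oo)%E by exact: Lp_superlevel_finite p1 _ _ _ _ Lh e0.
  have [F [Fc FE]] := cpart_functional b s A mA Aoo.
  have [C [C0 HC]] := Rintegral_cpart_bound mu p p1 b s A mA Aoo.
  have ig := integrable_cpart mu p p1 b s A g mA Aoo Lg.
  have iw x := integrable_cpart mu p p1 b s A (iota x) mA Aoo (iotaLp x).
  have Fg : F (w n) @[n --> \oo] -->
      (Rintegral mu A (fun x => cpart b s (g x)) : R^o).
    apply/cvgrPdist_le => e' e'0.
    have : C * rLp_norm mu p (fun x => iota (w n) x - g x) @[n --> \oo] --> C * 0.
      by apply: cvgMl_tmp.
    rewrite mulr0 => /cvgrPdist_le/(_ _ e'0); apply: filterS => n.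
    rewrite sub0r normrN => h1; rewrite distrC FE -RintegralB//.
    apply: le_trans (le_trans (ler_norm _) h1).
    apply: le_trans (HC _ _); last exact: in_LpB (ltW p1) _ _ (iotaLp _) Lg.
    by under eq_Rintegral do rewrite -cpartB.
  have FuE := cvg_unique (@norm_hausdorff _ _) (wu F Fc) Fg.
  have : Rintegral mu A (fun x => cpart b s (h x)) = 0.
    under eq_Rintegral do rewrite cpartB.
    by rewrite RintegralB// -FE FuE subrr.
  have ih := integrable_cpart mu p p1 b s A h mA Aoo Lh.
  have ie : mu.-integrable A (EFin \o (fun=> e)).
    apply/integrableP; split; first exact/measurable_EFinP.
    by under eq_integral do rewrite /=; rewrite integral_cst// lte_mul_pinfty ?lee_fin.
  have := le_Rintegral mA ie ih (fun x Ax => ltW Ax).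
  rewrite Rintegral_cst// => + hh; rewrite hh pmulr_rle0// => A0.
  apply/eqP; rewrite -(@fineK _ (mu A)) ?ge0_fin_numE// eqe eq_le A0/=.
  exact: fine_ge0.
have hle b s : \forall x \ae mu, cpart b s (h x) <= 0.
  have [N [mN N0 sN]] : mu.-negligible
      (\bigcup_k [set x | k.+1%:R^-1 < cpart b s (h x)]).
    apply: negligible_bigcup => k; apply/negligibleP.
      exact: measurable_superlevel (in_Lp_measurable _ _ _ Lh).
    by apply: h0; rewrite invr_gt0.
  exists N; split => // x /= /negP; rewrite -ltNge => hx; apply: sN.
  (* With [k] the integer part of the inverse of a positive value, [k.+1] exceeds that inverse, so
     the value exceeds [k.+1%:R^-1]. *)
  exists (Num.truncn (cpart b s (h x))^-1) => //=.
  rewrite -[ltRHS]invrK ltf_pV2 ?posrE ?invr_gt0 ?ltr0n//.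
  exact: truncnS_gt.
near=> x => _; apply/eqP; rewrite -subr_eq0; apply/eqP.
by apply: (cpart_le0_eq0 (h x)) => -[] []; near: x; exact: hle.
Unshelve. all: by end_near. Qed.

End WeakLimit.

(** * Subsequences and strong convergence on balls *)

Lemma subsequence_cvg (phi : nat -> nat) : subsequence phi ->
  phi n @[n --> \oo] --> \oo.
Proof.
move=> phi_homo; have phi_ge n : (n <= phi n)%N.
  by elim: n => // n IH; exact: leq_ltn_trans IH (phi_homo _ _ (ltnSn n)).
move=> A [N _ NA]; exists N => // n /= Nn; apply: NA => /=.
exact: leq_trans Nn (phi_ge n).
Qed.

Lemma not_cvg0_subsequence {R : realType} (a : nat -> R) :
  ~ (a n @[n --> \oo] --> 0) ->
  exists e : R, 0 < e /\ exists psi, subsequence psi /\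
    forall n, e <= `|a (psi n)|.
Proof.
move=> /cvgrPdist_lt/existsNP[e /not_implyP[e0 Ne]]; exists e; split => //.
have /choice[f fP] : forall N, exists n, (N <= n)%N /\ e <= `|a n|.
  move=> N; apply: contrapT => /forallNP H; apply: Ne; exists N => // n /= Nn.
  rewrite sub0r normrN ltNge; apply/negP => h; exact: (H n).
pose psi := fix psi k := if k is k'.+1 then f (psi k').+1 else f 0%N.
exists psi; split; last by case=> [|n]; exact: (fP _).2.
apply: homo_ltn => [x y z|i]; first exact: ltn_trans.
exact: (fP _).1.
Qed.

Section LocalConvergence.
Context {R : realType} {M : pointedMetricType R}.
Variables (p : R) (p1 : 1 < p) (mu : {measure set (borelType M) -> \bar R}).
Context {X : normedModType R} (iota : X -> borelType M -> R[i]).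
Hypothesis hX : function_space_in_Lp mu p iota.
Hypothesis hXcont : continuously_imbedded mu p iota.
Hypothesis hXcomp : locally_compactly_imbedded mu p iota.

Lemma iota_in_Lp u : in_Lp mu p (iota u).
Proof. by case: hX. Qed.

Lemma iota_linear_ae (a : R) (u v : X) :
  iota (a *: u + v) = (fun x => a%:C%C * iota u x + iota v x) %[ae mu].
Proof. by case: hX => _ + _; exact. Qed.

Lemma iota_bounded : exists C : R, forall u, rLp_norm mu p (iota u) <= C * `|u|.
Proof.
have [C HC] := hXcont; exists C => u.
by rewrite -lee_fin -rLp_normE//; exact: iota_in_Lp.
Qed.

Lemma iotaB_ae (u v : X) :
  iota (u - v) = (fun x => iota u x - iota v x) %[ae mu].
Proof.
have := iota_linear_ae (-1) v u; apply: filterS => x /= /(_ I).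
rewrite scaleN1r addrC => -> _.
by rewrite rmorphN1 mulN1r addrC.
Qed.

(** If convergence failed, a subsequence would keep distance [e] from [u] on the ball. It is still
    bounded, so compactness extracts from it a strong limit [g]; uniqueness of the weak limit,
    applied to the restricted measure, gives [g = iota u] almost everywhere there, a
    contradiction. *)
Lemma local_strong_convergence (y : M) (r : R) (v : nat -> X) (u : X) :
  0 < r -> weakly_converges v u ->
  rLp_norm (mrestr mu (measurable_Kball y r)) p
    (fun x => iota (v n) x - iota u x) @[n --> \oo] --> 0.
Proof.
move=> r0 vu; set nu := mrestr mu _.
have iLp z : in_Lp nu p (iota z).
  by apply: (in_Lp_mrestr mu p (ltW p1)); exact: iota_in_Lp.
apply: contrapT => /not_cvg0_subsequence[e [e0 [psi [psi_sub psi_e]]]].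
have [C vC] := weakly_converges_bounded v u vu.
have [phi [g [phi_sub Lg wg]]] := hXcomp y r r0 (v \o psi)
  (ex_intro _ C (fun n => vC (psi n))).
pose w n := v (psi (phi n)).
have wu : weakly_converges w u.
  move=> F Fc; have := vu F Fc.
  move=> h; apply: (cvg_comp (fun n => psi (phi n)) (fun n => F (v n))) h.
  by apply: subsequence_cvg => m n mn; exact/psi_sub/phi_sub.
have {}wg : rLp_norm nu p (fun x => iota (w n) x - g x) @[n --> \oo] --> 0.
  by move/fine_cvgP : wg => -[_]; exact.
have gu : g = iota u %[ae nu].
  apply: (weak_limit_unique nu p p1 iota iLp _ _ w u g wu Lg wg).
  - by move=> a z z'; apply: ae_mrestr; exact: iota_linear_ae.
  - have [D HD] := iota_bounded; exists D => z; apply: le_trans (HD z).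
    by apply: (rLp_norm_mrestr_le mu p (ltW p1)); exact: iota_in_Lp.
have [n] : exists n, rLp_norm nu p (fun x => iota (w n) x - g x) < e.
  have /cvgrPdist_lt/(_ _ e0)[n _ /(_ n (leqnn n))] := wg.
  by rewrite sub0r normrN ger0_norm ?rLp_norm_ge0// => h; exists n.
rewrite ltNge => /negP; apply; apply: le_trans (psi_e (phi n)) _.
rewrite ger0_norm ?rLp_norm_ge0// /rLp_norm.
rewrite (Lp_norm_ae nu p (ltW p1) (fun x => iota (w n) x - iota u x)
  (fun x => iota (w n) x - g x))//.
- by apply: in_Lp_measurable; exact: in_LpB (ltW p1) _ _ (iLp _) (iLp _).
- by apply: in_Lp_measurable; exact: in_LpB (ltW p1) _ _ (iLp _) Lg.
- by apply: filterS gu => x /= /(_ I) -> _.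
Qed.

Lemma massE u : mass mu p iota u = (rLp_norm mu p (iota u) `^ p)%:E.
Proof. by rewrite /mass rLp_normE ?poweR_EFin//; exact: iota_in_Lp. Qed.

Lemma massB u v : mass mu p iota (u - v) =
  (rLp_norm mu p (fun x => iota u x - iota v x) `^ p)%:E.
Proof.
have iB := in_LpB mu p (ltW p1) _ _ (iota_in_Lp u) (iota_in_Lp v).
rewrite massE /rLp_norm (Lp_norm_ae mu p (ltW p1) _ _ _ _ (iotaB_ae u v))//.
- by apply: in_Lp_measurable; exact: iota_in_Lp.
- exact: in_Lp_measurable iB.
Qed.

Lemma rLp_norm_iota_eq0 u : rLp_norm mu p (iota u) = 0 -> u = 0.
Proof.
move=> u0; have [_ _ inj] := hX; apply: inj.
have mu_ := measurable_normc _ (in_Lp_measurable _ _ _ (iota_in_Lp u)).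
have : Lp_norm mu p (iota u) = 0%E by rewrite rLp_normE ?u0//; exact: iota_in_Lp.
move/Lnorm_eq0_eq0 => /(_ _ _)/= h.
have := h ((measurable_EFinP _ _).2 mu_); rewrite lte_fin => /(_ (lt_trans ltr01 p1)).
by apply: filterS => x /= /(_ I) [] /Normc.eq0_normc.
Qed.

Lemma mass_brezis_lieb (v : nat -> X) (u : X) (c : R) : weakly_converges v u ->
  (forall n, mass mu p iota (v n) = c%:E) ->
  rLp_norm mu p (fun x => iota (v n) x - iota u x) `^ p @[n --> \oo]
    --> c - rLp_norm mu p (iota u) `^ p.
Proof.
move=> vu vc.
(* Balls around an arbitrary point exhaust [M]; the radius is [k.+1] because local compactness is
   stated for positive radii. *)
apply: (brezis_lieb mu p (ltW p1) (fun k => Kball point k.+1%:R)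
  (fun k => measurable_Kball point k.+1%:R) (fun n => iota (v n)) (iota u)).
- move=> m n mn; apply/subsetPset => x /= h; apply: le_trans h _.
  by rewrite ler_nat.
- apply/seteqP; split => // x _.
  exists (Num.truncn (mdist x point)) => //=; exact/ltW/truncnS_gt.
- by move=> n; exact: iota_in_Lp.
- exact: iota_in_Lp.
- by move=> n; apply: EFin_inj; rewrite -massE vc.
- by move=> k; exact: local_strong_convergence.
Qed.

End LocalConvergence.

(** * The alternative *)

Section ConvergenceTools.
Context {R : realType}.

Lemma le_limn_esup (a b : nat -> \bar R) : (forall n, a n <= b n)%E ->
  (limn_esup a <= limn_esup b)%E.
Proof.
move=> ab; rewrite !limn_esup_lim.
apply: lee_lim; [exact: is_cvg_esups|exact: is_cvg_esups|apply: nearW => n].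
apply: ge_ereal_sup => _ [k /= nk <-]; apply: le_trans (ab k) _.
by apply: ereal_sup_ubound; exists k.
Qed.

Lemma cvg_within_continuous (A : set R) (f : R -> \bar R) (a : nat -> R) (l : R) :
  {within A, continuous f} -> A l -> a n @[n --> \oo] --> l ->
  (\forall n \near \oo, A (a n)) -> f (a n) @[n --> \oo] --> f l.
Proof.
move=> /subspace_continuousP fc Al al Aa.
apply: cvg_comp (fc l Al) => B /= lB.
have := al _ lB; move: Aa; apply: filterS2 => n Aan; exact.
Qed.

Lemma powR_cvg0_inv (p : R) (a : nat -> R) : 0 < p -> (forall n, 0 <= a n) ->
  a n `^ p @[n --> \oo] --> 0 -> a n @[n --> \oo] --> 0.
Proof.
move=> p0 a0 /cvgrPdist_lt ap; apply/cvgrPdist_lt => e e0.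
apply: filterS (ap _ (powR_gt0 p e0)) => n.
rewrite !sub0r !normrN !ger0_norm ?powR_ge0// => h.
rewrite ltNge; apply/negP => ea; move: h; rewrite ltNge => /negP; apply.
by apply: ge0_ler_powR; rewrite ?nnegrE ?(ltW p0) ?(ltW e0).
Qed.

End ConvergenceTools.

Theorem theorem2p4 (R : realType) (p c : R) (hp : 2 <= p) (hc : 0 < c)
  (M : pointedMetricType R) (mu : {measure set (borelType M) -> \bar R})
  (hmu : locally_finite mu)
  (X : completeNormedModType R) (iota : X -> borelType M -> R[i])
  (hX : function_space_in_Lp mu p iota)
  (hXnontrivial : exists v : X, v != 0)
  (hXcont : continuously_imbedded mu p iota)
  (hXcomp : locally_compactly_imbedded mu p iota)
  (E : X -> R) (hE : continuous E) (hE0 : E 0 = 0)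
  (hEt : forall t : R, 0 <= t -> (-oo < ground_energy mu p iota E t)%E)
  (hsup : weak_limit_superadditive mu p iota E)
  (hsub : strictly_subadditive_upto (ground_energy mu p iota E) c)
  (hcont : {within `[0, c], continuous (ground_energy mu p iota E)})
  (u_ : nat -> X) (hu_ : minimizing_sequence mu p iota E c u_)
  (phi : nat -> nat) (hphi : subsequence phi)
  (u : X) (hu : weakly_converges (fun n => u_ (phi n)) u) :
  u = 0 \/
  [/\ Lp_norm mu p (fun x => iota (u_ (phi n)) x - iota u x) @[n --> \oo]
        --> 0%E,
      u != 0 &
      minimizer mu p iota E c u].
Proof.
have p1 : 1 < p by apply: lt_le_trans hp; rewrite ltr1n.
have p0 : 0 < p by exact: lt_trans p1.
have [->|u0] := eqVneq u 0; [by left|right].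
have [mu_c Eu_c] := hu_.
pose v n := u_ (phi n).
pose G := ground_energy mu p iota E.
have vmin : minimizing_sequence mu p iota E c v.
  split=> [n|]; first exact: mu_c.
  exact: cvg_comp (subsequence_cvg _ hphi) Eu_c.
pose t := rLp_norm mu p (iota u) `^ p.
have ut : mass mu p iota u = t%:E by rewrite massE.
have t0 : 0 < t.
  rewrite lt_neqAle powR_ge0 andbT eq_sym.
  by apply: contra_neq u0 => /powR_eq0_eq0; exact: rLp_norm_iota_eq0.
have vu : rLp_norm mu p (fun x => iota (v n) x - iota u x) `^ p @[n --> \oo]
    --> c - t.
  by apply: mass_brezis_lieb => // n; exact: mu_c.
have tc : t <= c.
  by rewrite -subr_ge0; apply: (cvgr_to_ge vu); apply: nearW => n; exact: powR_ge0.
have [psi [psi_sub psi_sup]] := hsup c hc v u vmin hu.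
pose s n := rLp_norm mu p (fun x => iota (v (psi n)) x - iota u x) `^ p.
have s_lim : s n @[n --> \oo] --> c - t.
  exact: cvg_comp (subsequence_cvg _ psi_sub) vu.
(* [v (psi n) - u] competes in the infimum at its own mass [s n], so its energy is at least
   [G (s n)], which tends to [G (c - t)]. *)
have GcE : ((E u)%:E + G (c - t)%R <= G c)%E.
  have vpsi : (E (v (psi n)))%:E @[n --> \oo] --> G c.
    exact: cvg_comp (subsequence_cvg _ psi_sub) vmin.2.
  have [_ <-] := cvg_limn_einf_sup vpsi.
  apply: le_trans psi_sup; apply: leeD => //.
  have Gs : G (s n) @[n --> \oo] --> G (c - t)%R.
    apply: (cvg_within_continuous _ _ _ _ hcont) => //.
      by rewrite /= in_itv/= subr_ge0 tc lerBlDr lerDl ltW.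
    (* [0 < t] is essential: the limit of [s n] lies strictly below [c], so [s n] eventually stays
       in the interval on which [G] is continuous. *)
    have st : c - t < c by rewrite ltrBlDr ltrDl.
    move/cvgr_lt : s_lim => /(_ _ st); apply: filterS => n /ltW snc.
    by rewrite /= in_itv/= snc powR_ge0.
  have [_ <-] := cvg_limn_einf_sup Gs; apply: le_limn_esup => n.
  by apply: ereal_inf_lbound; exists (v (psi n) - u) => //=; rewrite massB.
have GtE : (G t <= (E u)%:E)%E by apply: ereal_inf_lbound; exists u.
(* For [t < c] both [t] and [c - t] are positive, and strict subadditivity would give [G c < G t + G
   (c - t) <= E u + G (c - t) <= G c]. *)
have {}tc : t = c.
  apply/eqP; rewrite eq_le tc leNgt; apply/negP => tltc.
  have := hsub t (c - t) t0; rewrite subr_gt0 => /(_ tltc).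
  rewrite addrC subrK lexx => /(_ isT); rewrite ltNge => /negP; apply.
  by apply: le_trans GcE; apply: leeD.
(* Only the zero element has mass [0], and its energy is [0]. *)
have G0 : (0 <= G 0%R)%E.
  apply: le_ereal_inf_tmp => _ [w /= + <-].
  rewrite (massE p mu iota hX) => -[] /powR_eq0_eq0.
  by move=> /(rLp_norm_iota_eq0 p p1 mu iota hX) ->; rewrite hE0.
split => //.
- rewrite (_ : (fun n => _) = fun n =>
      (rLp_norm mu p (fun x => iota (v n) x - iota u x))%:E); last first.
    apply/funext => n; rewrite rLp_normE//.
    by apply: in_LpB (ltW p1) _ _ _ _; exact: iota_in_Lp.
  (* [vu] holds along all of [v]; the extraction [psi] served the energies only, so strong
     convergence costs no further subsequence. *)
  have vu0 : rLp_norm mu p (fun x => iota (v n) x - iota u x) @[n --> \oo] --> 0.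
    apply: (powR_cvg0_inv p _ p0) => [n|]; first exact: rLp_norm_ge0.
    by move: vu; rewrite tc subrr.
  by apply/fine_cvgP; split; [exact: nearW|exact: vu0].
- split; first by rewrite ut tc.
  apply/eqP; rewrite eq_le; apply/andP; split.
    apply: le_trans GcE; rewrite tc subrr.
    exact: leeDl.
  by rewrite -tc.
Qed.
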